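(* Let $(X,\mathcal{O})$ be an ultrametrizable space. Let $T_X$ and $(\lceil X\rceil,d_{T_X})$ be a representing tree and a corresponding representing clade space of $(X,\mathcal{O})$. Then the completion of the clade space $(\lceil X\rceil,d_{T_X})$ is the canopy $([T_X],d_{T_X})$ (and therefore $(X,\mathcal{O})$ is completely ultrametrizable if and only if $\lceil X\rceil=[T_X]$).
   Context: $\mathbb{N}=\{0,1,2,\dots\}$. An ultrametric on $X$ is a metric $d$ with $d(x,y)\le\max\{d(x,z),d(z,y)\}$ for all $x,y,z$; a topological space is ultrametrizable if some ultrametric induces its topology, and completely ultrametrizable if some complete ultrametric induces its topology. A set $A\subset[0,\infty)$ is sequentially-descending-to-zero if there is a sequence $(a_k)_{k\in\mathbb{N}}$ of non-negative reals converging to $0$ with $A=\{0\}\cup\{a_k: k\in\mathbb{N}\}$. A metric $d$ is sequentially-descending-to-zero if its image $\operatorname{im} d$ is such a set. Every ultrametrizable topology is induced by some sequentially-descending-to-zero ultrametric. Closed balls are $\overline{B}(x,r)=\{y\in X: d(x,y)\le r\}$, $r\ge 0$ (so $\overline{B}(x,0)=\{x\}$). Representing tree and clade space. Let $(X,d)$ be a sequentially-descending-to-zero ultrametric space, and let $(r_k)_{k\in\mathbb{N}}$ be a weakly decreasing sequence of non-negative reals such that $\operatorname{im} d=\{0\}\cup\{r_k:k\in\mathbb{N}\}$ and, for every $k$, if $r_k>0$ then $r_k>r_{k+1}$. Put $\mathcal{A}_{(X,d)}=\{\overline{B}(x,r_k): x\in X,\ k\in\mathbb{N}\setminus\{0\}\}$.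 The representing tree is $$T_{(X,d)}=\{\emptyset\}\cup\left\{\left(\overline{B}(x,r_j)\right)_{j=1}^{k}: x\in X,\ k\in\mathbb{N}\setminus\{0\}\right\}.$$ Its canopy $[T_{(X,d)}]$ is the set of its branches, i.e. of all sequences in $\mathcal{A}_{(X,d)}^{\mathbb{N}}$ all of whose finite prefixes lie in $T_{(X,d)}$. Define $\lceil X\rceil=\left\{\left(\overline{B}(x,r_{k+1})\right)_{k\in\mathbb{N}}: x\in X\right\}\subseteq[T_{(X,d)}]$, and for sequences $u,v\in\mathcal{A}_{(X,d)}^{\mathbb{N}}$ (indexed from $0$) define $d_{T_{(X,d)}}(u,v)=0$ if $u=v$ and $d_{T_{(X,d)}}(u,v)=r_{\min\{k\in\mathbb{N}: u_k\ne v_k\}}$ otherwise. The representing clade space of $(X,d)$ is $\lceil X\rceil$ with the restriction of $d_{T_{(X,d)}}$. A representing tree $T_X$ and corresponding representing clade space $(\lceil X\rceil,d_{T_X})$ of an ultrametrizable space $(X,\mathcal{O})$ are the representing tree $T_{(X,d)}$ and representing clade space $(\lceil X\rceil,d_{T_{(X,d)}})$ of $(X,d)$, for a sequentially-descending-to-zero ultrametric $d$ on $X$ inducing $\mathcal{O}$.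
   Formalization: The parenthetical fails for a fixed tree (X={1/n}, d=max: discrete, d incomplete). Proved instead: the given d is complete iff ⌈X⌉=[T_X], and (X,O) is completely ultrametrizable iff ⌈X⌉=[T_X] for some representing tree. *)

(* Defs.v *)
From mathcomp Require Import all_boot all_order all_algebra.
From mathcomp Require Import all_classical all_reals all_analysis.

Set Implicit Arguments.
Unset Strict Implicit.
Unset Printing Implicit Defensive.
Import Order.TTheory GRing.Theory Num.Theory numFieldNormedType.Exports.
Local Open Scope classical_set_scope.
Local Open Scope ring_scope.

(* Metrics are explicit functions, relativized to a carrier set E : set U,
   rather than instances of [metricType]: several metrics are considered on the
   same topological space, and the clade space and the canopy are two carriers
   for the same distance function. *)

Definition is_metric_on (R : realType) (U : Type) (E : set U)
    (d : U -> U -> R) : Prop :=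
  [/\ forall x y, E x -> E y -> 0 <= d x y,
      forall x y, E x -> E y -> (d x y = 0 <-> x = y),
      forall x y, E x -> E y -> d x y = d y x
    & forall x y z, E x -> E y -> E z -> d x y <= d x z + d z y].

Definition is_ultrametric (R : realType) (X : Type) (d : X -> X -> R) : Prop :=
  is_metric_on setT d /\ forall x y z, d x y <= Num.max (d x z) (d z y).

Definition metric_cauchy (R : realType) (U : Type) (d : U -> U -> R)
    (u : nat -> U) : Prop :=
  forall e : R, 0 < e -> \forall m & n \near \oo, d (u m) (u n) < e.

Definition metric_cvg (R : realType) (U : Type) (d : U -> U -> R)
    (u : nat -> U) (l : U) : Prop :=
  d (u n) l @[n --> \oo] --> (0 : R).

Definition complete_on (R : realType) (U : Type) (E : set U)
    (d : U -> U -> R) : Prop :=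
  forall u : nat -> U, (forall n, E (u n)) -> metric_cauchy d u ->
    exists2 l, E l & metric_cvg d u l.

Definition dense_on (R : realType) (U : Type) (D E : set U)
    (d : U -> U -> R) : Prop :=
  forall x, E x -> forall e : R, 0 < e -> exists2 y, D y & d x y < e.

(* (E, dE) is the completion of its subspace (D, dD). *)
Definition is_completion (R : realType) (U : Type) (D : set U)
    (dD : U -> U -> R) (E : set U) (dE : U -> U -> R) : Prop :=
  [/\ is_metric_on E dE,
      complete_on E dE,
      D `<=` E,
      forall x y, D x -> D y -> dD x y = dE x y
    & dense_on D E dE].

Definition induces (R : realType) (X : topologicalType) (d : X -> X -> R) :
    Prop :=
  forall A : set X, open A <->
    forall x, A x -> exists2 e : R, 0 < e & [set y | d x y < e] `<=` A.

Definition ultrametrizable (R : realType) (X : topologicalType) : Prop :=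
  exists2 d : X -> X -> R, is_ultrametric d & induces d.

Definition completely_ultrametrizable (R : realType) (X : topologicalType) :
    Prop :=
  exists d : X -> X -> R,
    [/\ is_ultrametric d, complete_on setT d & induces d].

Definition im_dist (R : realType) (X : Type) (d : X -> X -> R) : set R :=
  [set t | exists x y, t = d x y].

Definition seq_desc_to_zero (R : realType) (A : set R) : Prop :=
  exists a : nat -> R,
    [/\ forall k, 0 <= a k,
        a @ \oo --> (0 : R)
      & A = [set 0] `|` range a].

(* r is the sequence (r_k) of radii attached to d. *)
Definition radii (R : realType) (X : Type) (d : X -> X -> R) (r : nat -> R) :
    Prop :=
  [/\ forall k, 0 <= r k,
      nonincreasing_seq r,
      im_dist d = [set 0] `|` range r
    & forall k, 0 < r k -> r k.+1 < r k].

(* The data (d, r) from which a representing tree and the corresponding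
   representing clade space of the space X are built. *)
Definition representing_data (R : realType) (X : topologicalType)
    (d : X -> X -> R) (r : nat -> R) : Prop :=
  [/\ is_ultrametric d, induces d, seq_desc_to_zero (im_dist d) & radii d r].

Definition cball (R : realType) (X : Type) (d : X -> X -> R) (x : X) (t : R) :
    set X :=
  [set y | d x y <= t].

Definition tree_alphabet (R : realType) (X : Type) (d : X -> X -> R)
    (r : nat -> R) : set (set X) :=
  [set B | exists x k, (0 < k)%N /\ B = cball d x (r k)].

Definition rep_tree (R : realType) (X : Type) (d : X -> X -> R)
    (r : nat -> R) : set (seq (set X)) :=
  [set s | s = [::] \/
     exists x k, (0 < k)%N /\ s = [seq cball d x (r j) | j <- iota 1 k]].

Definition branches (A : Type) (alphabet : set A) (T : set (seq A)) :
    set (nat -> A) :=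
  [set u | (forall n, alphabet (u n)) /\ forall n, T (mkseq u n)].

Definition canopy (R : realType) (X : Type) (d : X -> X -> R)
    (r : nat -> R) : set (nat -> set X) :=
  branches (tree_alphabet d r) (rep_tree d r).

Definition clade_set (R : realType) (X : Type) (d : X -> X -> R)
    (r : nat -> R) : set (nat -> set X) :=
  [set u | exists x, u = fun k => cball d x (r k.+1)].

(* min {k | u k <> v k}; the default value 0 is only used when u = v. *)
Definition first_diff (A : Type) (u v : nat -> A) : nat :=
  xget 0%N [set k | u k <> v k /\ forall j, (j < k)%N -> u j = v j].

Definition tree_dist (R : realType) (A : Type) (r : nat -> R)
    (u v : nat -> A) : R :=
  if `[< u = v >] then 0 else r (first_diff u v).

(* Main.v *)
Require Import Defs.
From mathcomp Require Import all_boot all_order all_algebra.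
From mathcomp Require Import all_classical all_reals all_analysis.
From mathcomp Require Import lra.

Set Implicit Arguments.
Unset Strict Implicit.
Unset Printing Implicit Defensive.
Import Order.TTheory GRing.Theory Num.Theory numFieldNormedType.Exports.
Local Open Scope classical_set_scope.
Local Open Scope ring_scope.

(** The canopy is the space of coherent choices of balls, one for each radius,
    and the tree distance of two such choices is the radius at which they
    first disagree. Two facts drive everything.

    - The map sending [x] to its sequence of balls ([clade]) is an isometry from
      [(X, d)] onto the clade set ([tree_dist_clade]): if [d x y = r k > 0],
      the balls of radius [r k] and more about [x] and [y] coincide, and those
      of radius [r k.+1 < r k] do not.
    - A sequence of sets is a branch if and only if each of its finite prefixes
      is a prefix of some clade ([canopyP]). So the canopy is the closure of
      the clade set for prefix agreement. Since [r] tends to [0]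
      ([desc_nonincreasing_cvg0]), agreement on long prefixes is the same as
      closeness. This gives density, and a Cauchy sequence of branches
      stabilizes at each index, so its pointwise limit is again a branch.

    One point needs care: when [r k = 0], disagreement at [k] would be invisible
    to the distance, and it is excluded because balls of radius [0] are
    singletons ([canopy_eq0]).

    Hence the canopy is the completion of an isometric copy of [(X, d)], and a
    metric space is complete if and only if it is all of its completion
    ([complete_iff_completion_eq]).

    For the topological criterion, a complete ultrametric [e] inducing the
    topology need not take values descending to zero along a sequence. Rounding
    its values with [quantize] to [0] or to inverses of positive integers gives
    an ultrametric which does, and which is uniformly equivalent to [e], hence
    still complete and inducing the same topology. Radii for it are then
    obtained by listing its values in decreasing order ([exists_radii]). *)

(** * Metric notions in terms of epsilons, and sequences descending to zero *)

Lemma metric_cauchyP (R : realType) (U : Type) (d : U -> U -> R)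
    (u : nat -> U) :
  metric_cauchy d u <-> forall e : R, 0 < e ->
    exists N, forall m n, (N <= m)%N -> (N <= n)%N -> d (u m) (u n) < e.
Proof.
split=> h e e0.
- have [[A B] [[N1 _ h1] [N2 _ h2]] AB] := h e e0.
  exists (maxn N1 N2) => m n; rewrite !geq_max => /andP[m1 _] /andP[_ n2].
  by apply: (AB (m, n)); split; [apply: h1 | apply: h2].
- have [N hN] := h e e0.
  exists ([set m | (N <= m)%N], [set m | (N <= m)%N]).
    by split; exists N.
  by move=> [m n] [/= Nm Nn]; apply: hN.
Qed.

Lemma cvg0_geP (R : realType) (a : nat -> R) : (forall n, 0 <= a n) ->
  a @ \oo --> (0 : R) <->
  forall e : R, 0 < e -> exists N, forall n, (N <= n)%N -> a n < e.
Proof.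
move=> a0; split=> [/cvgrPdist_lt h e e0|h].
- have [N _ hN] := h e e0; exists N => n Nn.
  by have := hN n Nn; rewrite /= sub0r normrN ger0_norm.
- apply/cvgrPdist_lt => e e0; have [N hN] := h e e0.
  by exists N => // n Nn /=; rewrite sub0r normrN ger0_norm// hN.
Qed.

Lemma metric_cvgP (R : realType) (U : Type) (E : set U) (d : U -> U -> R)
    (u : nat -> U) (l : U) : is_metric_on E d -> (forall n, E (u n)) -> E l ->
  metric_cvg d u l <->
  forall e : R, 0 < e -> exists N, forall n, (N <= n)%N -> d (u n) l < e.
Proof. by move=> [d0 _ _ _] Eu El; apply: cvg0_geP => n; apply: d0. Qed.

(** If [r] stayed above [e > 0], it would be strictly decreasing, hence
    injective, with values among the finitely many terms of the defining
    sequence of [A] that are at least [e]. *)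
Lemma desc_nonincreasing_cvg0 (R : realType) (A : set R) (r : nat -> R) :
    seq_desc_to_zero A -> (forall k, 0 <= r k) -> (forall k, A (r k)) ->
    (forall k, 0 < r k -> r k.+1 < r k) -> nonincreasing_seq r ->
  forall e : R, 0 < e -> exists k, r k < e.
Proof.
move=> [a [a0 acvg ->]] r0 Ar rlt rni e e0; apply: contrapT => /forallNP re.
have {}re k : e <= r k by rewrite leNgt; apply/negP/re.
have [N hN] := (cvg0_geP a0).1 acvg e e0.
have idx k : exists n : 'I_N, a n = r k.
  case: (Ar k) => [rk0|[n _ ank]].
    by move: (re k); rewrite rk0 leNgt e0.
  have nN : (n < N)%N.
    by rewrite ltnNge; apply/negP => /hN; rewrite ank ltNge re.
  by exists (Ordinal nN).
have [f hf] := choice idx.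
have decr m n : (m < n)%N -> r n < r m.
  move=> mn; apply: le_lt_trans (rni _ _ mn) _.
  by apply: rlt; apply: lt_le_trans (re m).
have inj : injective (fun k : 'I_N.+1 => f k).
  move=> i j /= fij; have rij : r i = r j by rewrite -(hf i) -(hf j) fij.
  by apply/val_inj; case: (ltngtP i j) => // /decr; rewrite rij ltxx.
by have := leq_card _ inj; rewrite !card_ord ltnn.
Qed.

(** * The tree distance on arbitrary sequences *)

Lemma first_diffP (A : Type) (u v : nat -> A) : u <> v ->
  u (Defs.first_diff u v) <> v (Defs.first_diff u v) /\
  forall j, (j < Defs.first_diff u v)%N -> u j = v j.
Proof.
move=> uv; rewrite /Defs.first_diff; case: xgetP => [k _ []//|none].
exfalso; apply: uv; apply/funext => k; elim/ltn_ind: k => k ih.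
by apply: contrapT => uvk; apply: (none k).
Qed.

Lemma first_diffE (A : Type) (u v : nat -> A) k : u k <> v k ->
  (forall j, (j < k)%N -> u j = v j) -> Defs.first_diff u v = k.
Proof.
move=> uvk eqk.
have [|duv eqd] := @first_diffP _ u v; first by move=> uv; rewrite uv in uvk.
by case: (ltngtP (Defs.first_diff u v) k) => // [/eqk|/eqd].
Qed.

Lemma tree_dist_le (R : realType) (A : Type) (r : nat -> R) (u v : nat -> A)
    k : (forall k, 0 <= r k) -> nonincreasing_seq r ->
  (forall j, (j < k)%N -> u j = v j) -> tree_dist r u v <= r k.
Proof.
move=> r0 rni eqk; rewrite /tree_dist; case: asboolP => // uv.
have [duv _] := first_diffP uv; apply: rni.
by rewrite leqNgt; apply/negP => /eqk.
Qed.

Lemma tree_dist_ge (R : realType) (A : Type) (r : nat -> R) (u v : nat -> A)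
    k : nonincreasing_seq r -> u k <> v k -> r k <= tree_dist r u v.
Proof.
move=> rni uvk; rewrite /tree_dist.
case: asboolP => [uv|uv]; first by rewrite uv in uvk.
have [_ eqd] := first_diffP uv; apply: rni.
by rewrite leqNgt; apply/negP => /eqd.
Qed.

Lemma tree_dist_lt (R : realType) (A : Type) (r : nat -> R) (u v : nat -> A)
    k j : nonincreasing_seq r ->
  tree_dist r u v < r k -> (j <= k)%N -> u j = v j.
Proof.
move=> rni uvk jk; apply: contrapT => /(tree_dist_ge rni).
by rewrite leNgt (lt_le_trans uvk)// rni.
Qed.

Lemma tree_dist_ge0 (R : realType) (A : Type) (r : nat -> R) (u v : nat -> A) :
  (forall k, 0 <= r k) -> 0 <= tree_dist r u v.
Proof. by move=> r0; rewrite /tree_dist; case: asboolP. Qed.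

Lemma tree_distxx (R : realType) (A : Type) (r : nat -> R) (u : nat -> A) :
  tree_dist r u u = 0.
Proof. by rewrite /tree_dist; case: asboolP. Qed.

Lemma tree_distC (R : realType) (A : Type) (r : nat -> R) (u v : nat -> A) :
  tree_dist r u v = tree_dist r v u.
Proof.
rewrite /tree_dist; case: asboolP => [->|uv]; first by case: asboolP.
case: asboolP => [vu|_]; first by rewrite vu in uv.
have [duv eqd] := first_diffP uv.
by rewrite (@first_diffE _ v u (Defs.first_diff u v))// => [/esym|j /eqd].
Qed.

(** At the first index where [u] and [v] disagree, [w] disagrees with one of
    them. *)
Lemma tree_dist_ultra (R : realType) (A : Type) (r : nat -> R)
    (u v w : nat -> A) : (forall k, 0 <= r k) -> nonincreasing_seq r ->
  tree_dist r u v <= Num.max (tree_dist r u w) (tree_dist r w v).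
Proof.
move=> r0 rni; have [->|uv] := pselect (u = v).
  by rewrite tree_distxx le_max tree_dist_ge0.
have [duv eqd] := first_diffP uv.
apply: (le_trans (tree_dist_le r0 rni eqd)); rewrite le_max.
have [uw|uw] := pselect (u (Defs.first_diff u v) = w (Defs.first_diff u v)).
  by rewrite [X in _ || X]tree_dist_ge ?orbT// -uw.
by rewrite tree_dist_ge.
Qed.

(** * The isometry onto the clade set *)

Lemma max_le_add (R : realType) (a b : R) : 0 <= a -> 0 <= b ->
  Num.max a b <= a + b.
Proof. by move=> a0 b0; rewrite ge_max lerDl lerDr a0 b0. Qed.

Definition clade (R : realType) (X : Type) (d : X -> X -> R) (r : nat -> R)
  (x : X) : nat -> set X := fun k => cball d x (r k.+1).

Lemma clade_setE (R : realType) (X : Type) (d : X -> X -> R) (r : nat -> R) :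
  clade_set d r = range (clade d r).
Proof.
by apply/seteqP; split=> u [x]; [move=> ->; exists x | move=> _ <-; exists x].
Qed.

Lemma cball_eq (R : realType) (X : Type) (d : X -> X -> R) x y t :
  is_ultrametric d -> d x y <= t -> cball d x t = cball d y t.
Proof.
move=> [[_ _ dC _] du] xyt; apply/seteqP; split=> z /= h.
  by apply: le_trans (du y z x) _; rewrite ge_max h dC// xyt.
by apply: le_trans (du x z y) _; rewrite ge_max h xyt.
Qed.

(** With [d x y = r k > 0], strict decrease at [k] makes [r k.+1] a radius that
    separates [x] from [y], whereas all earlier balls about [x] contain [y]. *)
Lemma tree_dist_clade (R : realType) (X : Type) (d : X -> X -> R)
    (r : nat -> R) x y : is_ultrametric d -> radii d r ->
  tree_dist r (clade d r x) (clade d r y) = d x y.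
Proof.
move=> du [r0 rni im rlt]; have [[d0 deq dC _] _] := du.
have [xy|xy] := pselect (x = y).
  by rewrite xy tree_distxx; apply/esym/deq.
have dxy : 0 < d x y.
  rewrite lt_neqAle d0// andbT; apply/eqP => /esym h.
  by apply: xy; apply/deq.
have : im_dist d (d x y) by exists x, y.
rewrite im => -[/= z|[k _ rk]]; first by move: dxy; rewrite z ltxx.
have diffk : clade d r x k <> clade d r y k.
  move=> /(congr1 (fun B : set X => B y)); rewrite /clade /cball /=.
  have -> : d y y = 0 by apply/deq.
  rewrite r0 => h; have : d x y <= r k.+1 by rewrite h.
  by rewrite leNgt -rk rlt// rk.
rewrite /tree_dist; case: asboolP => [h|_].
  by case: diffk; rewrite h.
rewrite (first_diffE diffk)// => j jk.
by apply: cball_eq => //; rewrite -rk; apply: rni.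
Qed.

Lemma iotaS1_mkseq (A : Type) (f : nat -> A) n :
  [seq f j | j <- iota 1 n] = mkseq (fun j => f j.+1) n.
Proof. by rewrite /mkseq -[1%N]addn0 iotaDl -map_comp. Qed.

(** * The canopy as completion of the clade set *)

(** This form is easier to use than the definition by sequences of the tree:
    membership becomes a condition on each finite prefix. *)
Lemma canopyP (R : realType) (X : Type) (d : X -> X -> R) (r : nat -> R)
    (u : nat -> set X) :
  canopy d r u <->
  forall n, exists x, forall j, (j < n)%N -> u j = clade d r x j.
Proof.
split=> [[al T] n|h].
  case: n => [|n]; first by have [x _] := al 0%N; exists x.
  have [//|[x [k [_]]]] := T n.+1.
  rewrite (iotaS1_mkseq (fun j => cball d x (r j))) => e.
  have kn : n.+1 = k by have := congr1 size e; rewrite !size_mkseq.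
  exists x => j jn; have := congr1 (fun s => nth set0 s j) e.
  by rewrite !nth_mkseq -?kn.
split=> n.
  by have [x hx] := h n.+1; exists x, n.+1; rewrite hx.
case: n => [|n]; [by left | right].
have [x hx] := h n.+1; exists x, n.+1; split=> //.
rewrite (iotaS1_mkseq (fun j => cball d x (r j))).
apply: (@eq_from_nth _ set0); rewrite ?size_mkseq// => j jn.
by rewrite !nth_mkseq// hx.
Qed.

Lemma clade_canopy (R : realType) (X : Type) (d : X -> X -> R) (r : nat -> R)
  x : canopy d r (clade d r x).
Proof. by apply/canopyP => n; exists x. Qed.

(** If the prefixes of length [k.+1] of [u] and [v] are those of the clades of
    [x] and [y], agreement below [k] gives [d x y <= r k = 0], so [x = y].
    This is what makes the tree distance separate branches, and lets Cauchy
    sequences stabilize also at the indices of zero radius. *)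
Lemma canopy_eq0 (R : realType) (X : Type) (d : X -> X -> R) (r : nat -> R)
    (u v : nat -> set X) k :
  is_ultrametric d -> radii d r -> canopy d r u -> canopy d r v ->
  r k = 0 -> (forall j, (j < k)%N -> u j = v j) -> u k = v k.
Proof.
move=> du dr /canopyP/(_ k.+1)[x ux] /canopyP/(_ k.+1)[y vy] rk uv.
have [r0 rni _ _] := dr.
rewrite ux// vy//; suff -> : x = y by [].
have [[d0 deq _ _] _] := du.
apply/deq => //; apply/eqP; rewrite eq_le d0// andbT -rk.
rewrite -(tree_dist_clade _ _ du dr); apply: tree_dist_le => // j jk.
by rewrite -ux ?uv ?vy// ltnW.
Qed.

Lemma canopy_metric (R : realType) (X : Type) (d : X -> X -> R)
    (r : nat -> R) : is_ultrametric d -> radii d r ->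
  is_metric_on (canopy d r) (tree_dist r).
Proof.
move=> du dr; have [r0 rni _ _] := dr; split.
- by move=> u v _ _; apply: tree_dist_ge0.
- move=> u v uc vc; split=> [uv0|->]; last exact: tree_distxx.
  apply: contrapT => uv; have [duv eqd] := first_diffP uv.
  apply: duv; apply: (canopy_eq0 du dr) => //.
  by move: uv0; rewrite /tree_dist; case: asboolP.
- by move=> u v _ _; apply: tree_distC.
- move=> u v w _ _ _; apply: le_trans (tree_dist_ultra u v w r0 rni) _.
  by apply: max_le_add; apply: tree_dist_ge0.
Qed.

(** Each coordinate of a Cauchy sequence is eventually constant; the sequence of
    these eventual values is a branch since each of its prefixes is a prefix of
    a term of the sequence. *)
Lemma canopy_complete (R : realType) (X : Type) (d : X -> X -> R)
    (r : nat -> R) : is_ultrametric d -> radii d r ->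
  (forall e, 0 < e -> exists k, r k < e) ->
  complete_on (canopy d r) (tree_dist r).
Proof.
move=> du dr rcvg u uc /metric_cauchyP uC; have [r0 rni _ _] := dr.
have stab k : exists N, forall m n, (N <= m)%N -> (N <= n)%N ->
    forall j, (j < k)%N -> u m j = u n j.
  elim: k => [|k [N hN]]; first by exists 0%N.
  (* Being at distance less than [r k] gives agreement up to [k] included, but
     only if [r k > 0]. *)
  have [rk0|] := eqVneq (r k) 0.
    exists N => m n Nm Nn j; rewrite ltnS leq_eqVlt => /orP[/eqP ->|].
      by apply: (canopy_eq0 du dr) => // i ik; apply: hN.
    exact: hN.
  move=> rk; have [|M hM] := uC (r k); first by rewrite lt_neqAle eq_sym rk r0.
  by exists M => m n Mm Mn j jk; apply: (tree_dist_lt rni (hM m n Mm Mn)).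
have [N hN] := choice stab.
pose l k := u (N k.+1) k.
have lP k m : (N k <= m)%N -> forall j, (j < k)%N -> u m j = l j.
  move=> km j jk.
  have Nm := leq_maxl m (N j.+1); have NN := leq_maxr m (N j.+1).
  rewrite (hN k m (maxn m (N j.+1)))// ?(leq_trans km)//.
  by rewrite (hN j.+1 _ (N j.+1)).
have lc : canopy d r l.
  apply/canopyP => n; have /canopyP/(_ n)[x hx] := uc (N n).
  by exists x => j jn; rewrite -hx// (lP n).
exists l => //; apply/(metric_cvgP (canopy_metric du dr)) => // e /rcvg[k rk].
exists (N k) => n kn; apply: le_lt_trans rk.
by apply: tree_dist_le => //; apply: lP.
Qed.

Lemma clade_dense (R : realType) (X : Type) (d : X -> X -> R)
    (r : nat -> R) : radii d r ->
  (forall e, 0 < e -> exists k, r k < e) ->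
  dense_on (clade_set d r) (canopy d r) (tree_dist r).
Proof.
move=> [r0 rni _ _] rcvg u /canopyP uc e /rcvg[k rk].
have [x hx] := uc k; exists (clade d r x); first by exists x.
by apply: le_lt_trans rk; apply: tree_dist_le.
Qed.

Lemma canopy_completion (R : realType) (X : Type) (d : X -> X -> R)
    (r : nat -> R) : is_ultrametric d -> radii d r ->
  seq_desc_to_zero (im_dist d) ->
  is_completion (clade_set d r) (tree_dist r) (canopy d r) (tree_dist r).
Proof.
move=> du dr desc; have [r0 rni im rlt] := dr.
have rcvg : forall e, 0 < e -> exists k, r k < e.
  apply: (desc_nonincreasing_cvg0 desc) => // k.
  by rewrite im; right; exists k.
split.
- exact: canopy_metric.
- exact: canopy_complete.
- by rewrite clade_setE => u [x _ <-]; apply: clade_canopy.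
- by [].
- exact: clade_dense.
Qed.

(** * Completeness of a space embedded in its completion *)

(** A point of the completion is a limit of points of [range f], hence of a
    Cauchy sequence in [X]; if [X] is complete the limit lies in [range f]. The
    metric space is given as the source of an isometry [f] so that the lemma
    applies to the clade map. *)
Lemma complete_iff_completion_eq (R : realType) (X U : Type)
    (d : X -> X -> R) (f : X -> U) (E : set U) (dE : U -> U -> R) :
  is_metric_on setT d -> (forall x y, dE (f x) (f y) = d x y) ->
  is_completion (range f) dE E dE ->
  complete_on setT d <-> range f = E.
Proof.
move=> dm fd [Em Ec DE _ dns]; have [E0 Eeq EC Etri] := Em.
have Ef x : E (f x) by apply: DE; exists x.
split=> [dc|fE].
  apply/seteqP; split=> // u Eu.
  have app n : exists x, dE u (f x) < n.+1%:R^-1.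
    have [|_ [x _ <-]] := dns u Eu n.+1%:R^-1; first by rewrite invr_gt0.
    by exists x.
  have [x hx] := choice app.
  have inv_small (e : R) : 0 < e ->
      exists N, forall n, (N <= n)%N -> dE u (f (x n)) < e.
    move=> e0; exists (Num.truncn e^-1) => n Nn; apply: lt_le_trans (hx n) _.
    rewrite invf_ple ?posrE ?ltr0n//.
    by apply: le_trans (ltW (truncnS_gt _)) _; rewrite ler_nat.
  have half (e : R) : 0 < e -> 0 < e / 2 by move=> e0; rewrite divr_gt0.
  have [//||l _ xl] := dc x.
    apply/metric_cauchyP => e /half/inv_small[N hN]; exists N => m n Nm Nn.
    rewrite -fd; apply: le_lt_trans (Etri _ _ u _ _ _) _ => //.
    by rewrite EC//; have := hN m Nm; have := hN n Nn; lra.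
  exists l => //; apply/esym/Eeq => //; apply/eqP; rewrite eq_le E0// andbT.
  rewrite leNgt; apply/negP => /half pos.
  have [N hN] := inv_small _ pos.
  have [M hM] := (metric_cvgP dm (fun=> I) I).1 xl _ pos.
  have := Etri _ _ (f (x (maxn N M))) Eu (Ef l) (Ef _).
  have := hN _ (leq_maxl N M); have := hM _ (leq_maxr N M).
  by rewrite fd; lra.
move=> x _ /metric_cauchyP xC.
have [n||l El fl] := Ec (f \o x); first exact: Ef.
  by apply/metric_cauchyP => e /xC[N hN]; exists N => m n ? ?; rewrite fd hN.
move: El; rewrite -fE => -[y _ yl]; exists y => //.
by rewrite /metric_cvg; under eq_fun do rewrite -fd yl.
Qed.

Lemma complete_iff_clade_canopy (R : realType) (X : topologicalType)
    (d : X -> X -> R) (r : nat -> R) : representing_data d r ->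
  complete_on setT d <-> clade_set d r = canopy d r.
Proof.
move=> [du _ desc dr]; have := canopy_completion du dr desc.
rewrite clade_setE; apply: complete_iff_completion_eq; first by case: du.
by move=> x y; apply: tree_dist_clade.
Qed.

(** * Enumerating the values of a distance in decreasing order *)

(** Only finitely many elements of [B] lie above a given positive one. *)
Lemma desc_has_max (R : realType) (A B : set R) :
  seq_desc_to_zero A -> B `<=` A -> B !=set0 ->
  exists m, B m /\ forall b, B b -> b <= m.
Proof.
move=> [a [a0 acvg AE]] BA [b Bb].
have A0 t : A t -> 0 <= t by rewrite AE => -[->|[k _ <-]].
have [[c Bc c0]|npos] := pselect (exists2 c, B c & 0 < c); last first.
  exists b; split=> // c Bc; apply: le_trans (A0 _ (BA _ Bb)).
  by rewrite leNgt; apply/negP => c0; apply: npos; exists c.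
have [N hN] := (cvg0_geP a0).1 acvg c c0.
have idx t : B t -> c <= t -> exists n : 'I_N, a n = t.
  move=> Bt ct; have := BA _ Bt; rewrite AE => -[t0|[n _ ant]].
    by move: ct; rewrite t0 leNgt c0.
  have nN : (n < N)%N.
    by rewrite ltnNge; apply/negP => /hN; rewrite ant ltNge ct.
  by exists (Ordinal nN).
have [i ai] := idx c Bc (lexx _).
have Pi : `[< B (a i) >] by apply/asboolP; rewrite ai.
have [m /asboolP Bm mmax] :=
  @Order.TotalTheory.arg_maxP _ _ _ i (fun j : 'I_N => `[< B (a j) >])
    (fun j => a j) Pi.
exists (a m); split=> // t Bt.
have cm : c <= a m by rewrite -ai; apply: mmax.
have [ct|/ltW tc] := leP c t; last exact: le_trans cm.
have [j aj] := idx t Bt ct; rewrite -aj; apply: mmax.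
by apply/asboolP; rewrite aj.
Qed.

(** The value is [0] for sets without a greatest element, in particular for the
    empty set: this makes [descent] continue with zeros once [0] is reached. *)
Definition greatest (R : realType) (B : set R) : R :=
  xget 0 [set m | B m /\ forall b, B b -> b <= m].

Fixpoint descent (R : realType) (A : set R) (k : nat) : R :=
  if k is j.+1 then greatest (A `&` [set t | t < descent A j]) else greatest A.

(** The sequence [descent] strictly decreases to [0], and it skips no positive
    value [t]: at the first index where it drops below [t], the preceding term
    must be [t], because otherwise [t] itself would have been a better choice
    for the next term. A point [x0] is needed for [0] to be a distance. *)
Lemma exists_radii (R : realType) (X : Type) (d : X -> X -> R) (x0 : X) :
  is_metric_on setT d -> seq_desc_to_zero (im_dist d) ->
  exists r, radii d r.
Proof.
move=> [_ deq _ _]; set A := im_dist d => desc.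
have A0 : A 0 by exists x0, x0; apply/esym/deq.
have Age0 t : A t -> 0 <= t.
  by case: desc => a [a0 _ ->] [->|[k _ <-]].
have grP B : B `<=` A -> B !=set0 ->
    B (greatest B) /\ forall b, B b -> b <= greatest B.
  move=> BA /(desc_has_max desc BA) [m mP].
  by rewrite /greatest; case: xgetP => [//|/(_ m)].
pose r := descent A.
have r0P : A (r 0%N) /\ forall b, A b -> b <= r 0%N.
  by apply: grP => //; exists 0.
have rSP k : 0 < r k -> [/\ A (r k.+1), r k.+1 < r k &
    forall b, A b -> b < r k -> b <= r k.+1].
  move=> rk; have [||[Ar lt] mx] := grP (A `&` [set t | t < r k]).
  - by move=> t [].
  - by exists 0.
  - by split=> // b Ab bk; apply: mx.
have rS0 k : r k = 0 -> r k.+1 = 0.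
  move=> rk; rewrite (_ : r k.+1 = greatest (A `&` [set t | t < r k]))//.
  by rewrite /greatest; case: xgetP => // m _ [[Am /=]]; rewrite rk ltNge Age0.
have Ar k : A (r k).
  elim: k => [|k Ark]; first by case: r0P.
  have [rk0|rk] := eqVneq (r k) 0; first by rewrite rS0.
  by have [] := rSP k; first by rewrite lt_neqAle eq_sym rk Age0.
have rlt k : 0 < r k -> r k.+1 < r k by move=> /rSP[].
have rni : nonincreasing_seq r.
  apply/nonincreasing_seqP => k.
  have [rk0|rk] := eqVneq (r k) 0; first by rewrite rS0 // rk0.
  by apply/ltW/rlt; rewrite lt_neqAle eq_sym rk Age0.
exists r; split=> // [k|]; first exact: Age0.
apply/seteqP; split=> [t At|_ [->//|[k _ <-]]]; last exact: Ar.
have [->|t0] := eqVneq t 0; [by left | right].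
have tpos : 0 < t by rewrite lt_neqAle eq_sym t0 Age0.
have rex : exists k, r k < t.
  by apply: (desc_nonincreasing_cvg0 desc) => // k; apply: Age0.
case: (ex_minnP rex) => -[|k] rk kmin.
  by move: rk; rewrite ltNge r0P.2.
have tk : t <= r k.
  by rewrite leNgt; apply/negP => /kmin; rewrite ltnn.
exists k => //; apply/eqP; rewrite eq_le tk andbT leNgt; apply/negP => tlt.
have [|_ _ /(_ t At tlt)] := rSP k; first exact: lt_trans tlt.
by rewrite leNgt rk.
Qed.

(** * Uniformly equivalent distances *)

(** The identity map from [(X, d)] to [(X, d')] is uniformly continuous. *)
Definition unif_finer (R : realType) (X : Type) (d d' : X -> X -> R) : Prop :=
  forall e : R, 0 < e ->
    exists2 e', 0 < e' & forall x y, d x y < e' -> d' x y < e.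

Lemma unif_finer_induces (R : realType) (X : topologicalType)
    (d d' : X -> X -> R) : unif_finer d d' -> unif_finer d' d ->
  induces d -> induces d'.
Proof.
move=> dd' d'd ind A; rewrite ind; split=> h x /h[e e0 eA].
- have [e' e'0 he] := d'd e e0; exists e' => // y /= xy.
  exact/eA/he.
- have [e' e'0 he] := dd' e e0; exists e' => // y /= xy.
  exact/eA/he.
Qed.

Lemma unif_finer_complete (R : realType) (X : Type) (d d' : X -> X -> R) :
  is_metric_on setT d -> is_metric_on setT d' ->
  unif_finer d d' -> unif_finer d' d -> complete_on setT d ->
  complete_on setT d'.
Proof.
move=> dm dm' dd' d'd dc u _ /metric_cauchyP uC.
have [//||l _ ul] := dc u.
  apply/metric_cauchyP => e /d'd[e' /uC[N hN] he].
  by exists N => m n Nm Nn; apply/he/hN.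
exists l => //; apply/(metric_cvgP dm') => // e /dd'[e' e'0 he].
have [N hN] := (metric_cvgP dm (fun=> I) I).1 ul _ e'0.
by exists N => n Nn; apply/he/hN.
Qed.

(** * Rounding an ultrametric to a sequentially descending one *)

(** Monotone rounding of [[0, oo)] to [0] and the numbers [1 / n.+1]. The case
    [t = 0] is separate because [0^-1 = 0] would give the value [1]. *)
Definition quantize (R : realType) (t : R) : R :=
  if t == 0 then 0 else (Num.truncn t^-1).+1%:R^-1.

Lemma quantize_ge0 (R : realType) (t : R) : 0 <= quantize t.
Proof. by rewrite /quantize; case: ifP => // _; rewrite invr_ge0. Qed.

Lemma quantize_eq0 (R : realType) (t : R) : quantize t = 0 <-> t = 0.
Proof.
rewrite /quantize; have [->|t0] := eqVneq t 0; first by [].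
by split=> /eqP; [rewrite invr_eq0 pnatr_eq0 | rewrite (negPf t0)].
Qed.

Lemma quantize_le (R : realType) (s t : R) : 0 <= s -> s <= t ->
  quantize s <= quantize t.
Proof.
move=> s0 st; have [->|sn0] := eqVneq s 0.
  by rewrite (quantize_eq0 0).2// quantize_ge0.
have {s0}sn0 : 0 < s by rewrite lt_neqAle eq_sym sn0.
have t0 : 0 < t by apply: lt_le_trans st.
rewrite /quantize !gt_eqF// lef_pV2 ?posrE ?ltr0n// ler_nat ltnS.
by apply: le_truncn; rewrite lef_pV2.
Qed.

Lemma quantize_leid (R : realType) (t : R) : 0 <= t -> quantize t <= t.
Proof.
move=> t0; rewrite /quantize; case: eqVneq => // tn0.
have {t0}tn0 : 0 < t by rewrite lt_neqAle eq_sym tn0.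
by rewrite invf_ple ?posrE ?ltr0n// ltW// truncnS_gt.
Qed.

Lemma quantize_lt (R : realType) (t : R) n : 0 <= t ->
  quantize t < n.+1%:R^-1 -> t <= n.+1%:R^-1.
Proof.
move=> t0; rewrite /quantize; case: eqVneq => [-> _|tn0].
  by rewrite invr_ge0.
have {t0}tn0 : 0 < t by rewrite lt_neqAle eq_sym tn0.
rewrite ltf_pV2 ?posrE ?ltr0n// ltr_nat ltnS => nt.
rewrite -[t]invrK lef_pV2 ?posrE ?ltr0n ?invr_gt0//.
by rewrite -truncn_ge_nat// invr_ge0 ltW.
Qed.

(** A nondecreasing function commutes with [max], so it preserves the strong
    triangle inequality. *)
Lemma quantize_ultrametric (R : realType) (X : Type) (d : X -> X -> R) :
  is_ultrametric d -> is_ultrametric (fun x y => quantize (d x y)).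
Proof.
move=> [[d0 deq dC _] du].
have qu x y z : quantize (d x y) <=
    Num.max (quantize (d x z)) (quantize (d z y)).
  have := du x y z; rewrite !le_max => /orP[h|h].
    by rewrite quantize_le// d0.
  by rewrite [X in _ || X]quantize_le ?orbT// d0.
split=> //; split.
- by move=> *; apply: quantize_ge0.
- by move=> x y _ _; rewrite quantize_eq0; apply: deq.
- by move=> x y _ _; rewrite dC.
- move=> x y z _ _ _; apply: le_trans (qu x y z) _.
  by apply: max_le_add; apply: quantize_ge0.
Qed.

Lemma quantize_unif (R : realType) (X : Type) (d : X -> X -> R) :
  is_metric_on setT d ->
  unif_finer d (fun x y => quantize (d x y)) /\
  unif_finer (fun x y => quantize (d x y)) d.
Proof.
move=> [d0 _ _ _]; split=> e e0.
  exists e => // x y; apply: le_lt_trans; apply: quantize_leid; exact: d0.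
pose n := Num.truncn e^-1.
exists n.+1%:R^-1 => [|x y]; first by rewrite invr_gt0.
move=> /quantize_lt h; apply: le_lt_trans (h (d0 _ _ I I)) _.
by rewrite invf_plt ?posrE ?ltr0n// truncnS_gt.
Qed.

Lemma quantize_desc (R : realType) (X : Type) (d : X -> X -> R) (x0 : X) :
  is_metric_on setT d ->
  seq_desc_to_zero (im_dist (fun x y => quantize (d x y))).
Proof.
move=> [_ deq _ _]; set A := im_dist _.
have A0 : A 0 by exists x0, x0; apply/esym/quantize_eq0/deq.
pose a k : R := if `[< A k.+1%:R^-1 >] then k.+1%:R^-1 else 0.
have a0 k : 0 <= a k by rewrite /a; case: asboolP; rewrite ?invr_ge0.
exists a; split=> //.
- apply/cvg0_geP => // e e0; exists (Num.truncn e^-1) => n Nn.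
  apply: (@le_lt_trans _ _ n.+1%:R^-1).
    by rewrite /a; case: asboolP; rewrite ?invr_ge0.
  rewrite invf_plt ?posrE ?ltr0n//.
  by apply: lt_le_trans (truncnS_gt _) _; rewrite ler_nat.
- apply/seteqP; split=> [t At|t [->//|[k _ <-]]]; last first.
    by rewrite /a; case: asboolP.
  have [x [y txy]] := At; move: (txy); rewrite /quantize.
  case: eqVneq => [_ ->|_ tE]; [by left | right].
  by exists (Num.truncn (d x y)^-1) => //; rewrite /a -tE; case: asboolP.
Qed.

Theorem proposition4p15 (R : realType) (X : topologicalType)
    (d : X -> X -> R) (r : nat -> R)
    (hX : ultrametrizable R X) (hT : representing_data d r) :
  [/\ is_completion (clade_set d r) (tree_dist r) (canopy d r) (tree_dist r),
      complete_on setT d <-> clade_set d r = canopy d r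
    & completely_ultrametrizable R X <->
      exists (d' : X -> X -> R) (r' : nat -> R),
        representing_data d' r' /\ clade_set d' r' = canopy d' r'].
Proof.
have [du _ desc dr] := hT; split.
- exact: canopy_completion.
- exact: complete_iff_clade_canopy.
split=> [[e [eu ec ei]]|[d' [r' [hT' /(complete_iff_clade_canopy hT') d'c]]]].
(* [0] belongs to the image of [d] by the choice of the radii [r], so [X] has a
   point. *)
- have [x0 _] : im_dist d 0 by have [_ _ -> _] := dr; left.
  have em := eu.1; have qu := quantize_ultrametric eu.
  have [eq qe] := quantize_unif em; have qdesc := quantize_desc x0 em.
  have [r' r'P] := exists_radii x0 qu.1 qdesc.
  have qT : representing_data (fun x y => quantize (e x y)) r'.
    by split=> //; apply: unif_finer_induces ei.
  exists (fun x y => quantize (e x y)), r'; split=> //.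
  apply/(complete_iff_clade_canopy qT).
  by apply: unif_finer_complete ec => //; exact: qu.1.
- by exists d'; have [? ? _ _] := hT'; split.
Qed.
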